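(* Let $D \subset \mathbb{R}^n$ be a set of finite Lebesgue measure, let $T$ be a finite set, and let $f: D \to T$ be a measurable function. Then for any $\epsilon>0$ there exist a linear logical function $L: D \to T\cup\{\ast\}$, where $T\cup\{\ast\}$ is $T$ adjoined with one extra element $\ast\notin T$, and a measurable set $E \subset \mathbb{R}^n$ of Lebesgue measure less than $\epsilon$ such that $L|_{D-E} \equiv f|_{D-E}$.
   Context: $D$ is a Lebesgue measurable subset of $\mathbb{R}^n$ and $T$ carries the discrete $\sigma$-algebra. Linear logical functions. For an affine linear function $l=(l_1,\ldots,l_k)$ on $\mathbb{R}^n$, the chambers of $l$ are the regions into which $\mathbb{R}^n$ is subdivided by the hyperplanes $\{l_i=0\}$; they are defined to contain some of their boundary strata in such a way that they are disjoint and their union is $\mathbb{R}^n$ (concretely: the nonempty sets obtained by imposing, for each $i$, either $l_i\ge 0$ or $l_i<0$). Let $D\subset\mathbb{R}^n$ and let $S$ be a finite set. A linear logical graph $(G,L)$ consists of a finite directed graph $G$ (parallel arrows allowed) with no oriented cycle, with exactly one source vertex (vertex with no incoming arrow) and exactly $|S|$ target vertices (vertices with no outgoing arrow), identified with the elements of $S$, together with a collection $L=\{l_v\}$ of affine linear functions on $\mathbb{R}^n$, one for each vertex $v$ having more than one outgoing arrow, such that the chambers of $l_v$ are in one-to-one correspondence with the outgoing arrows of $v$. It determines a function $f_{G,L}: D\to S$: given $x\in D$, start at the source vertex; at a vertex with exactly one outgoing arrow follow that arrow; at a vertex $v$ with more than one outgoing arrow follow the arrow corresponding to the chamber of $l_v$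 containing $x$; this stops at a target vertex, and $f_{G,L}(x)\in S$ is the element associated to it. A function $D\to S$ is a linear logical function if it equals $f_{G,L}$ for some linear logical graph $(G,L)$. *)

(* Defs.v *)
From HB Require Import structures.
From mathcomp Require Import all_boot all_order all_algebra.
From mathcomp Require Import all_classical all_reals all_analysis.

Set Implicit Arguments.
Unset Strict Implicit.
Unset Printing Implicit Defensive.
Import Order.TTheory GRing.Theory Num.Theory.
Import numFieldNormedType.Exports.
Local Open Scope classical_set_scope.
Local Open Scope ring_scope.

Section lebesgue_rV.
Variables (R : realType) (n : nat).
Implicit Types (a b x : 'rV[R]_n) (A : set 'rV[R]_n).

Definition box a b : set 'rV[R]_n :=
  [set x | forall i, x ord0 i \in `[a ord0 i, b ord0 i[].

(* The maximum with 0 makes boxes with b i < a i for some i, which are empty,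
   have volume 0. *)
Definition box_volume a b : R :=
  \prod_(i < n) Num.max 0 (b ord0 i - a ord0 i).

Lemma box_volume_ge0 a b : 0 <= box_volume a b.
Proof. by apply: prodr_ge0 => i _; rewrite le_max lexx. Qed.

(* The boxes of a cover are indexed by an arbitrary set of natural numbers, so
   covers may be finite, and the empty set has outer measure 0 also for n = 0,
   where no box is empty. *)
Definition box_cover A : set (set nat * (nat -> 'rV[R]_n * 'rV[R]_n)) :=
  [set c | A `<=` \bigcup_(k in c.1) box (c.2 k).1 (c.2 k).2].

Definition cover_volume (c : set nat * (nat -> 'rV[R]_n * 'rV[R]_n)) : \bar R :=
  (\esum_(k in c.1) (box_volume (c.2 k).1 (c.2 k).2)%:E)%E.

Definition lebesgue_outer A : \bar R :=
  ereal_inf [set cover_volume c | c in box_cover A].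

Local Open Scope ereal_scope.

Lemma cover_volume_ge0 c : 0 <= cover_volume c.
Proof. by apply: esum_ge0 => k _; rewrite lee_fin box_volume_ge0. Qed.

Lemma lebesgue_outer_ge0 A : 0 <= lebesgue_outer A.
Proof. by apply: le_ereal_inf_tmp => _ [c _ <-]; exact: cover_volume_ge0. Qed.

Lemma lebesgue_outer0 : lebesgue_outer set0 = 0.
Proof.
apply/eqP; rewrite eq_le lebesgue_outer_ge0 andbT.
apply: ereal_inf_lbound; exists (set0, fun=> (0%R, 0%R)) => //.
by rewrite /cover_volume /= esum_set0.
Qed.

Lemma le_lebesgue_outer : {homo lebesgue_outer : A B / A `<=` B >-> A <= B}.
Proof.
move=> A B AB; apply: ereal_inf_le_tmp => _ [c Bc <-]; exists c => //.
exact: subset_trans AB Bc.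
Qed.

Lemma lebesgue_outer_sigma_subadditive : sigma_subadditive lebesgue_outer.
Proof.
move=> A; have [[i ioo]|] := pselect (exists i, lebesgue_outer (A i) = +oo).
  rewrite (eseries_pinfty _ _ ioo) ?leey// => m _.
  by rewrite -ltNye (lt_le_trans _ (lebesgue_outer_ge0 _)).
rewrite -forallNE => Aoo.
apply/lee_addgt0Pr => _/posnumP[e].
rewrite (le_trans _ (epsilon_trick _ _ _))//; last first.
  by move=> m; exact: lebesgue_outer_ge0.
have [G PG] : {G : nat -> set nat * (nat -> 'rV[R]_n * 'rV[R]_n) &
    forall m, box_cover (A m) (G m) /\ cover_volume (G m) <=
      lebesgue_outer (A m) + (e%:num / (2 ^ m.+1)%:R)%:E}.
  apply: (@choice _ _ (fun m (c : set nat * _) => box_cover (A m) c /\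
    cover_volume c <= lebesgue_outer (A m) + (e%:num / (2 ^ m.+1)%:R)%:E)) => m.
  have Afin : lebesgue_outer (A m) \is a fin_num.
    by rewrite ge0_fin_numE ?lebesgue_outer_ge0// ltey; apply/eqP/Aoo.
  have em : (0 < e%:num / (2 ^ m.+1)%:R :> R)%R by [].
  have [_ [c Ac <-] cA] := lb_ereal_inf_adherent em Afin.
  by exists c; split => //; exact: ltW.
have /card_esym/ppcard_eqP[f] := card_nat2.
pose J := [set k | (G (f k).1).1 (f k).2].
pose F k := (G (f k).1).2 (f k).2.
apply: (@le_trans _ _ (cover_volume (J, F))).
  apply: ereal_inf_lbound; exists (J, F) => // x [m _ Amx].
  have [j Gj xj] := (PG m).1 x Amx.
  by exists (f^-1%FUN (m, j)); rewrite /J /F /= invK ?inE.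
have v0 m j : 0 <= (box_volume ((G m).2 j).1 ((G m).2 j).2)%:E.
  by rewrite lee_fin box_volume_ge0.
have -> : cover_volume (J, F) = \sum_(m <oo) cover_volume (G m).
  rewrite nneseries_esumT; last by move=> m; exact: cover_volume_ge0.
  rewrite /cover_volume esum_esum//=.
  rewrite (@reindex_esum _ _ _ J _ f)//; split.
  - by move=> k; rewrite /J /=.
  - by move=> k l _ _; apply: inj; rewrite inE.
  - move=> [m j] [_ /= Gmj]; exists (f^-1%FUN (m, j)); last by rewrite invK ?inE.
    by rewrite /J /= invK ?inE.
apply: lee_nneseries => [m _ _|m _]; first exact: cover_volume_ge0.
exact: (PG m).2.
Qed.

HB.instance Definition _ := isOuterMeasure.Build R 'rV[R]_n lebesgue_outer
  lebesgue_outer0 lebesgue_outer_ge0 le_lebesgue_outer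
  lebesgue_outer_sigma_subadditive.

Definition lebesgue_measurable A : Prop := lebesgue_outer.-cara.-measurable A.

Definition lebesgue_measure_rV :
  set (caratheodory_type lebesgue_outer) -> \bar R := lebesgue_outer.

HB.instance Definition _ := isMeasure.Build _ _ _ lebesgue_measure_rV
  (@caratheodory_measure0 _ _ lebesgue_outer)
  (@caratheodory_measure_ge0 _ _ lebesgue_outer)
  (@caratheodory_measure_sigma_additive _ _ lebesgue_outer).

(* The sigma-algebra on T is the discrete one. *)
Definition lebesgue_measurable_fun (T : Type) (D : set 'rV[R]_n) (f : D -> T) :=
  forall B : set T, lebesgue_measurable (set_val @` (f @^-1` B)).

End lebesgue_rV.

Section affine.
Variables (R : realType) (n k : nat).

Record affine_fun := AffineFun {
  affine_linear : 'M[R]_(n, k);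
  affine_const : 'rV[R]_k }.

Definition affine_eval (l : affine_fun) (x : 'rV[R]_n) : 'rV[R]_k :=
  x *m affine_linear l + affine_const l.

(* s i = true stands for l_i >= 0, s i = false for l_i < 0. *)
Definition sign_region (l : affine_fun) (s : 'I_k -> bool) : set 'rV[R]_n :=
  [set x | forall i, (0 <= affine_eval l x ord0 i) = s i].

Definition chambers (l : affine_fun) : set (set 'rV[R]_n) :=
  [set C | C !=set0 /\ exists s, C = sign_region l s].

End affine.

(* llg_dim and llg_affine are total for convenience; their values at vertices
   with at most one outgoing arrow, and the values of llg_chamber at the arrows
   leaving such vertices, are never used. *)
Record linear_logical_graph (R : realType) (n : nat) (S : finType) := {
  llg_vertex : finType;
  llg_arrow : finType;
  llg_src : llg_arrow -> llg_vertex;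
  llg_tgt : llg_arrow -> llg_vertex;
  llg_source : llg_vertex;
  llg_target : S -> llg_vertex;
  llg_dim : llg_vertex -> nat;
  llg_affine : forall v, affine_fun R n (llg_dim v);
  llg_chamber : llg_arrow -> set 'rV[R]_n;
  llg_acyclic : forall c : seq llg_vertex,
    cycle [rel u v | [exists e, (llg_src e == u) && (llg_tgt e == v)]] c ->
    c = [::];
  llg_sourceP : forall v, v = llg_source <-> forall e, llg_tgt e <> v;
  llg_target_inj : injective llg_target;
  llg_targetP : forall v,
    (exists s, v = llg_target s) <-> forall e, llg_src e <> v;
  llg_chamberP : forall v, (1 < #|[pred e | llg_src e == v]|)%N ->
    set_bij [set e | llg_src e = v] (chambers (llg_affine v)) llg_chamber }.

Section linear_logical_function.
Variables (R : realType) (n : nat) (S : finType).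
Variable G : linear_logical_graph R n S.
Implicit Types (x : 'rV[R]_n) (v : llg_vertex G) (e : llg_arrow G) (s : S).

Definition followed x e : Prop :=
  (1 < #|[pred e' | llg_src e' == llg_src e]|)%N -> llg_chamber e x.

Inductive llg_run x : llg_vertex G -> S -> Prop :=
| llg_run_stop s : llg_run x (llg_target G s) s
| llg_run_step e s : followed x e -> llg_run x (llg_tgt e) s ->
    llg_run x (llg_src e) s.

Lemma chamber_cover k (l : affine_fun R n k) x :
  exists2 C, chambers l C & C x.
Proof.
exists (sign_region l (fun i => 0 <= affine_eval l x ord0 i)) => //.
split; last by eexists.
by exists x.
Qed.

Lemma chamber_disjoint k (l : affine_fun R n k) C C' x :
  chambers l C -> chambers l C' -> C x -> C' x -> C = C'.
Proof.
move=> [_ [s ->]] [_ [s' ->]] sx s'x; congr (sign_region l _).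
by apply/funext => i; rewrite -(sx i) -(s'x i).
Qed.

Lemma followed_ex x v : (exists e, llg_src e = v) ->
  exists e, llg_src e = v /\ followed x e.
Proof.
move=> [e0 e0v]; have [v1|v1] := ltnP 1 #|[pred e | llg_src e == v]|.
  have [_ _ surj] := llg_chamberP v1.
  have [C lC Cx] := chamber_cover (llg_affine v) x.
  by have [e ev eC] := surj C lC; exists e; split => // _; rewrite eC.
by exists e0; split => //; rewrite /followed e0v ltnNge v1.
Qed.

Lemma followed_uniq x e e' : llg_src e = llg_src e' ->
  followed x e -> followed x e' -> e = e'.
Proof.
rewrite /followed => ee'; rewrite -ee'.
have [v1|v1] := ltnP 1 #|[pred e' | llg_src e' == llg_src e]|.
  move=> /(_ isT) ex /(_ isT) e'x.
  have [fun_ inj_ _] := llg_chamberP v1.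
  have e's : [set e | llg_src e = llg_src e] e' by [].
  apply: inj_; rewrite ?inE//=.
  by apply: (chamber_disjoint _ _ ex e'x); apply: fun_ => /=.
move=> _ _; move: v1 => /card_le1_eqP; apply; rewrite inE//.
by rewrite ee'.
Qed.

Lemma target_noarrow s e : llg_src e <> llg_target G s.
Proof. by move: e; apply/llg_targetP; exists s. Qed.

Lemma llg_run_uniq x v s s' : llg_run x v s -> llg_run x v s' -> s = s'.
Proof.
move=> H; elim: H s' => {v s} [s|e s ex _ IH] s'.
  move Ev : (llg_target G s) => v H.
  by case: H Ev => [t /llg_target_inj//|e t _ _ /esym/target_noarrow].
move Ev : (llg_src e) => v H; case: H Ev => [t /target_noarrow//|e' t e'x H' Ev].
by apply: IH; rewrite (followed_uniq Ev ex e'x).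
Qed.

Lemma llg_run_ex x v : exists s, llg_run x v s.
Proof.
pose adj := [rel u w : llg_vertex G |
  [exists e : llg_arrow G, (llg_src e == u) && (llg_tgt e == w)]].
suff aux m : forall p w, path adj w p -> uniq (w :: p) ->
    (#|llg_vertex G| <= size p + m)%N ->
    exists s, llg_run x (last w p) s.
  exact: (aux #|llg_vertex G| [::] v).
elim: m => [|m IH] p w wp up.
  rewrite addn0 => h2.
  have := max_card (mem (w :: p)); rewrite (card_uniqP up) /= => h1.
  by have := leq_trans h1 h2; rewrite ltnn.
move=> sz.
have [/llg_targetP[s ->]|/existsNP[e0 /contrapT e0v]] :=
    pselect (forall e : llg_arrow G, llg_src e <> last w p).
  by exists s; constructor.
have [e [ev ex]] := followed_ex x (ex_intro _ e0 e0v).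
have adje : adj (last w p) (llg_tgt e).
  by apply/existsP; exists e; rewrite ev !eqxx.
have new : llg_tgt e \notin w :: p.
  apply/negP => /[dup] tin /path.splitPl.
  case E : _ / => [p1 p2 lp1].
  have : cycle adj (llg_tgt e :: p2).
    rewrite /= rcons_path; move: wp adje.
    rewrite E cat_path last_cat lp1 => /andP[_ ->] /=; exact.
  by move=> /(@llg_acyclic _ _ _ G _).
have [] := IH (rcons p (llg_tgt e)) w.
- by rewrite rcons_path wp.
- by rewrite -rcons_cons rcons_uniq new.
- by rewrite size_rcons addSnnS.
move=> s; rewrite last_rcons => es; exists s; rewrite -ev.
exact: llg_run_step.
Qed.

Definition llg_fun x : S := sval (cid (llg_run_ex x (llg_source G))).

Lemma llg_funP x s : llg_fun x = s <-> llg_run x (llg_source G) s.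
Proof.
rewrite /llg_fun; case: cid => /= t xt; split => [<-//|xs].
exact: llg_run_uniq xt xs.
Qed.

End linear_logical_function.

Definition linear_logical_function (R : realType) (n : nat) (S : finType)
    (D : set 'rV[R]_n) (L : D -> S) : Prop :=
  exists G : linear_logical_graph R n S, forall x : D, L x = llg_fun G (set_val x).

(* Main.v *)
Require Import Defs.
From mathcomp Require Import all_boot all_order all_algebra.
From mathcomp Require Import all_classical all_reals all_analysis.
From mathcomp Require Import lra.

(** Lebesgue measurable sets of finite measure are finite unions of boxes up to
    small error, and a function that is decided by finitely many boxes is
    decided by the signs of finitely many affine functions.

    For each t in T let D_t be the fibre of f over t. It is measurable and has
    finite measure, so a cover of D_t by boxes whose total volume is almost the
    measure of D_t can be truncated to a finite union V_t such that the
    symmetric difference of D_t and V_t has measure at most eps / (#|T| + 1)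
    ([boxes_approx]). The exceptional set E is the union of these symmetric
    differences. At a point x of D outside E, the only V_t that contains x is
    the one with t = f x, so it suffices to output the t for which x lies in
    V_t.

    Whether x lies in V_t depends only on the signs of functions of the form
    x_i - c, namely those that bound the boxes. Take all these functions as the
    single affine function at the source vertex and join each of its chambers
    directly to the target that is the output on it ([two_level_graph]).

    The one obstacle is that every target needs an incoming arrow, since the
    source is the only vertex without one; hence the output must be onto
    T + {*}. Outside the V_t its values are irrelevant, as all points of D there
    lie in E. Since n > 0 there is room beyond the bounded sets V_t for one
    spare cube per element of T, and for a point in none of the boxes, where the
    output is * ([box_classifier]). *)

Set Implicit Arguments.
Unset Strict Implicit.
Unset Printing Implicit Defensive.
Import Order.TTheory GRing.Theory Num.Theory.
Import numFieldNormedType.Exports.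
Local Open Scope classical_set_scope.
Local Open Scope ring_scope.

(** * Boxes are Lebesgue measurable *)

Definition set_coord (R : realType) (n : nat) (a : 'rV[R]_n) (i : 'I_n) (c : R) :
  'rV[R]_n := \row_j (if j == i then c else a ord0 j).

(** The two sides are the lengths of the intervals [max a c, b[ and
    [a, min b c[, cut from [a, b[ at c, and of [a, b[ itself. *)
Lemma cut_length (R : realDomainType) (a b c : R) :
  Num.max 0 (b - Num.max a c) + Num.max 0 (Num.min b c - a) = Num.max 0 (b - a).
Proof.
by case: (leP a c) => ?; case: (leP b c) => ?; do ![case: leP => ?]; lra.
Qed.

Lemma box_volume_cut (R : realType) (n : nat) (a b : 'rV[R]_n) (i : 'I_n) (c : R) :
  box_volume (set_coord a i (Num.max (a ord0 i) c)) b +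
    box_volume a (set_coord b i (Num.min (b ord0 i) c)) = box_volume a b.
Proof.
have volE u v : box_volume u v =
    Num.max 0 (v ord0 i - u ord0 i) *
    \prod_(j < n | j != i) Num.max 0 (v ord0 j - u ord0 j).
  by rewrite /box_volume (bigD1 i).
rewrite !volE !mxE !eqxx -(cut_length (a ord0 i) (b ord0 i) c) mulrDl.
by congr (_ * _ + _ * _); apply: eq_bigr => j /negPf ji; rewrite mxE ji.
Qed.

(** Cutting each box of a cover of X by the hyperplane x_i = c yields covers of
    the two parts of X whose volumes add up to that of the original cover, so
    the half-space splits the outer measure of every X additively. *)
Lemma halfspace_measurable (R : realType) (n : nat) (i : 'I_n) (c : R) :
  lebesgue_measurable [set x : 'rV[R]_n | c <= x ord0 i].
Proof.
apply: le_caratheodory_measurable => X.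
apply: le_ereal_inf_tmp => _ [[J B] /= XB <-].
pose up k := (set_coord (B k).1 i (Num.max ((B k).1 ord0 i) c), (B k).2).
pose lo k := ((B k).1, set_coord (B k).2 i (Num.min ((B k).2 ord0 i) c)).
apply: (@le_trans _ _ (cover_volume (J, up) + cover_volume (J, lo))%E).
  apply: leeD; apply: ereal_inf_lbound.
    exists (J, up) => // x [/XB [k Jk Bx] cx]; exists k => // j /=.
    have := Bx j; rewrite !in_itv/= mxE; case: eqVneq => [->|//] /andP[ax ->].
    by rewrite ge_max ax cx.
  exists (J, lo) => // x [/XB [k Jk Bx] /negP cx]; exists k => // j /=.
  have := Bx j; rewrite !in_itv/= mxE; case: eqVneq => [->|//] /andP[-> bx].
  by rewrite lt_min bx ltNge cx.
rewrite /cover_volume -esumD/=; last 2 first.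
- by move=> k _; rewrite lee_fin box_volume_ge0.
- by move=> k _; rewrite lee_fin box_volume_ge0.
by apply: le_esum => k _; rewrite -EFinD box_volume_cut.
Qed.

Definition in_boxes (R : realType) (n : nat) (V : seq ('rV[R]_n * 'rV[R]_n))
    (x : 'rV[R]_n) : bool :=
  has (fun c : 'rV[R]_n * 'rV[R]_n => [forall i, x ord0 i \in `[c.1 ord0 i, c.2 ord0 i[]) V.

Lemma box_measurable (R : realType) (n : nat) (a b : 'rV[R]_n) :
  lebesgue_measurable (box a b).
Proof.
have -> : box a b = \big[setI/setT]_(i < n)
    ([set x : 'rV[R]_n | a ord0 i <= x ord0 i] `\`
     [set x : 'rV[R]_n | b ord0 i <= x ord0 i]).
  apply/seteqP; split => [x abx|x]; rewrite -bigcap_seq.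
    move=> i _; have := abx i; rewrite in_itv/= => /andP[ax bx].
    by split => //=; rewrite leNgt bx.
  move=> abx i; have [|/= ax] := abx i; first by rewrite /= mem_index_enum.
  by rewrite in_itv/= ax ltNge => /negP.
apply: (big_ind (@lebesgue_measurable R n)).
- exact: (@measurableT _ (caratheodory_type (@lebesgue_outer R n))).
- exact: (@measurableI _ (caratheodory_type (@lebesgue_outer R n))).
- move=> i _.
  by apply: (@measurableD _ (caratheodory_type (@lebesgue_outer R n)));
    exact: halfspace_measurable.
Qed.

Lemma in_boxes_measurable (R : realType) (n : nat)
    (V : seq ('rV[R]_n * 'rV[R]_n)) : lebesgue_measurable (in_boxes V).
Proof.
elim: V => [|c V IH].
  have -> : (in_boxes [::] : set _) = (set0 : set 'rV[R]_n) by apply/seteqP; split.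
  exact: (@measurable0 _ (caratheodory_type (@lebesgue_outer R n))).
have -> : (in_boxes (c :: V) : set _) = box c.1 c.2 `|` in_boxes V.
  apply/seteqP; split => x /=.
    by rewrite /in_boxes/= => /orP[/forallP|]; [left|right].
  by rewrite /in_boxes/= => -[cx|->]; rewrite ?orbT//; apply/orP; left; apply/forallP.
apply: (@measurableU _ (caratheodory_type (@lebesgue_outer R n))) => //.
exact: box_measurable.
Qed.

(** * Approximation by finite unions of boxes *)

(** Let U be the union of a cover of A by boxes with total volume less than
    mu A + e/2, and let V be the union of finitely many boxes of the cover whose
    volumes miss the total by less than e/2. Then A minus V is covered by the
    remaining boxes, and V minus A lies in U minus A, which has measure
    mu U - mu A because A is measurable. *)
Lemma boxes_approx (R : realType) (n : nat) (A : set 'rV[R]_n)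
    (mA : lebesgue_measurable A) (finA : (lebesgue_outer A < +oo)%E)
    (e : R) (e_gt0 : 0 < e) :
  exists V : seq ('rV[R]_n * 'rV[R]_n),
    (lebesgue_outer (A `+` in_boxes V) <= e%:E)%E.
Proof.
have e2 : 0 < e / 2 by rewrite divr_gt0.
have fA : lebesgue_outer A \is a fin_num.
  by rewrite ge0_fin_numE ?lebesgue_outer_ge0.
have [_ [[J B] /= AB <-] volB] := lb_ereal_inf_adherent e2 fA.
have B_ge0 k : (0 <= (box_volume (B k).1 (B k).2)%:E)%E.
  by rewrite lee_fin box_volume_ge0.
have fB : cover_volume (J, B) \is a fin_num.
  rewrite ge0_fin_numE ?cover_volume_ge0//; apply: (lt_trans volB).
  by rewrite lte_add_pinfty ?ltry.
have [_ [F [finF FJ] <-]] := ub_ereal_sup_adherent e2 fB.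
rewrite -/(esum _ _) -[X in (X - _ < _)%E -> _]/(cover_volume (J, B)) => volF.
have tail : (cover_volume (J `&` ~` F, B) <= (e / 2)%:E)%E.
  have := @esumID R _ F J (fun k => (box_volume (B k).1 (B k).2)%:E) (fun k _ => B_ge0 k).
  rewrite -[LHS]/(cover_volume (J, B)).
  rewrite -[X in (_ + X)%E]/(cover_volume (J `&` ~` F, B)).
  have -> : J `&` F = F by apply/setIidPr.
  rewrite (esum_fset finF) => [eqJ|k _]; last exact: B_ge0.
  move: volF; rewrite eqJ.
  have fF : (\sum_(k \in F) (box_volume (B k).1 (B k).2)%:E)%E \is a fin_num.
    rewrite ge0_fin_numE; last by apply: fsume_ge0 => // k _; exact: B_ge0.
    rewrite -(esum_fset finF) => [|k _]; last exact: B_ge0.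
    move: fB; rewrite eqJ esum_fset// => /fin_numPlt/andP[_].
    apply: le_lt_trans; rewrite leeDl// cover_volume_ge0//.
  rewrite lteBlDr// lteD2lE// => /ltW//.
have /finite_seqP[s Fs] := finF.
exists [seq B k | k <- s].
have inV x : in_boxes [seq B k | k <- s] x <->
    exists2 k, F k & box (B k).1 (B k).2 x.
  rewrite /in_boxes; split.
    move=> /hasP[_ /mapP[k kF ->] /forallP kx]; exists k => //.
    by rewrite Fs.
  move=> [k Fk kx]; apply/hasP; exists (B k); last exact/forallP.
  by apply/map_f; move: Fk; rewrite Fs.
rewrite (splitr e) EFinD.
apply: (le_trans (outer_measureU2 _ _ _)); apply: leeD.
  apply: le_trans tail; apply: ereal_inf_lbound; exists (J `&` ~` F, B) => //.
  move=> x [/AB [k Jk kx] /inV nV]; exists k => //; split => // Fk.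
  by apply: nV; exists k.
pose U := \bigcup_(k in J) box (B k).1 (B k).2.
have VU : in_boxes [seq B k | k <- s] `\` A `<=` U `&` ~` A.
  by move=> x [/inV[k Fk kx] nA]; split => //; exists k => //; exact: FJ.
apply: (le_trans (le_outer_measure _ _ _ VU)).
have muU : (lebesgue_outer U <= cover_volume (J, B))%E.
  by apply: ereal_inf_lbound; exists (J, B).
have := mA U; have -> : U `&` A = A by apply/setIidPr.
move=> eqU; move: (le_lt_trans muU volB); rewrite eqU lteD2lE//; exact: ltW.
Qed.

(** * Functions decided by signs of affine functions *)

Definition sign_pattern (R : realType) (n k : nat) (l : affine_fun R n k)
    (x : 'rV[R]_n) : {ffun 'I_k -> bool} :=
  [ffun i => 0 <= affine_eval l x ord0 i].

(** These index the chambers of l. *)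
Definition nonempty_pattern (R : realType) (n k : nat) (l : affine_fun R n k) :=
  {s : {ffun 'I_k -> bool} | `[< exists x, sign_pattern l x = s >]}.

Definition pattern_point (R : realType) (n k : nat) (l : affine_fun R n k)
    (s : nonempty_pattern l) : 'rV[R]_n :=
  sval (cid (asboolW (valP s))).

Lemma pattern_pointK (R : realType) (n k : nat) (l : affine_fun R n k)
    (s : nonempty_pattern l) : sign_pattern l (pattern_point s) = val s.
Proof. by rewrite /pattern_point; case: cid. Qed.

Lemma sign_regionE (R : realType) (n k : nat) (l : affine_fun R n k)
    (s : {ffun 'I_k -> bool}) (x : 'rV[R]_n) :
  sign_region l s x <-> sign_pattern l x = s.
Proof.
split => [sx|<- i]; last by rewrite ffunE.
by apply/ffunP => i; rewrite ffunE sx.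
Qed.

(** The graph has the source None, the targets Some s, and for each chamber one
    arrow from the source to the value of g on that chamber. Surjectivity of g
    gives every target an incoming arrow. When l has a single chamber the
    source has a single arrow, which is followed unconditionally. *)
Lemma two_level_graph (R : realType) (n k : nat) (S : finType)
    (l : affine_fun R n k) (g : 'rV[R]_n -> S)
    (g_l : forall x y, sign_pattern l x = sign_pattern l y -> g x = g y)
    (g_surj : forall s, exists x, g x = s) :
  exists G : linear_logical_graph R n S, forall x, llg_fun G x = g x.
Proof.
pose arr x : nonempty_pattern l := Sub (sign_pattern l x) (asboolT (ex_intro _ x erefl)).
pose tgt (e : nonempty_pattern l) := Some (g (pattern_point e)).
have tgt_arr x : tgt (arr x) = Some (g x).
  by congr Some; apply: g_l; rewrite pattern_pointK.
have acyc (c : seq (option S)) : cycle [rel u v |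
    [exists e, (None == u) && (tgt e == v)]] c -> c = [::].
  case: c => [//|v [|w c]] /=; first by rewrite andbT => /existsP[e /andP[/eqP<-]].
  case/andP => /existsP[e /andP[_ /eqP<-]].
  by case: c => [|z c] /= /andP[/existsP[]].
have srcP (v : option S) : v = None <-> forall e, tgt e <> v.
  split => [-> //|]; case: v => [s|//] sP.
  by have [x gx] := g_surj s; case: (sP (arr x)); rewrite tgt_arr gx.
have tgtP (v : option S) : (exists s, v = Some s) <->
    forall e : nonempty_pattern l, None <> v.
  split => [[s ->] //|]; case: v => [s|/(_ (arr 0))//]; first by exists s.
have chP (v : option S) : (1 < #|[pred e : nonempty_pattern l | None == v]|)%N ->
    set_bij [set e : nonempty_pattern l | None = v] (chambers l)
      (fun e => sign_region l (val e)).
  case: v => [s|_]; first by rewrite (eq_card (_ : _ =i pred0)) ?card0.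
  split.
  - move=> e _; split; last by eexists.
    by exists (pattern_point e); apply/sign_regionE; exact: pattern_pointK.
  - move=> e e' _ _ ee'; apply: val_inj; rewrite -[LHS]pattern_pointK.
    by apply/sign_regionE; rewrite -ee'; apply/sign_regionE; exact: pattern_pointK.
  - move=> C [[x Cx] [s defC]]; rewrite defC in Cx *.
    exists (arr x) => //; congr (sign_region l _).
    by apply/funext => i; rewrite ffunE Cx.
pose G := (@Build_linear_logical_graph R n S (option S) (nonempty_pattern l)
  (fun=> None) tgt None Some (fun=> k) (fun=> l) (fun e => sign_region l (val e))
  acyc srcP (@Some_inj _) tgtP chP).
exists G => x; apply/llg_funP; apply: (@llg_run_step _ _ _ G x (arr x)).
  by move=> _; apply/sign_regionE.
by rewrite /= tgt_arr; exact: (@llg_run_stop _ _ _ G).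
Qed.

(** The pair (i, c) stands for the hyperplane x_i = c. *)
Definition same_side (R : realType) (n : nat) (W : seq ('I_n * R))
    (x y : 'rV[R]_n) : Prop :=
  forall w, w \in W -> (w.2 <= x ord0 w.1) = (w.2 <= y ord0 w.1).

Lemma same_side_graph (R : realType) (n : nat) (S : finType)
    (W : seq ('I_n * R)) (g : 'rV[R]_n -> S)
    (g_W : forall x y, same_side W x y -> g x = g y)
    (g_surj : forall s, exists x, g x = s) :
  exists G : linear_logical_graph R n S, forall x, llg_fun G x = g x.
Proof.
pose l := @AffineFun R n (size W)
  (\matrix_(i, j) (i == (tnth (in_tuple W) j).1)%:R)
  (\row_j - (tnth (in_tuple W) j).2).
apply: (@two_level_graph R n _ S l) => // x y /ffunP xy; apply: g_W => w wW.
have evalE z j : (0 <= affine_eval l z ord0 j) =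
    ((tnth (in_tuple W) j).2 <= z ord0 (tnth (in_tuple W) j).1).
  rewrite !mxE subr_ge0 (bigD1 (tnth (in_tuple W) j).1)//= mxE eqxx mulr1.
  by rewrite big1 ?addr0// => i /negPf ij; rewrite mxE ij mulr0.
have /tnthP[j ->] : w \in in_tuple W by [].
by have := xy j; rewrite !ffunE !evalE.
Qed.

Definition box_walls (R : realType) (n : nat) (V : seq ('rV[R]_n * 'rV[R]_n)) :
    seq ('I_n * R) :=
  [seq (i, c.1 ord0 i) | c : 'rV[R]_n * 'rV[R]_n <- V, i : 'I_n <- enum 'I_n] ++
  [seq (i, c.2 ord0 i) | c : 'rV[R]_n * 'rV[R]_n <- V, i : 'I_n <- enum 'I_n].

Lemma in_boxes_same_side (R : realType) (n : nat) (V : seq ('rV[R]_n * 'rV[R]_n))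
    (W : seq ('I_n * R)) (x y : 'rV[R]_n) :
  {subset box_walls V <= W} -> same_side W x y -> in_boxes V x = in_boxes V y.
Proof.
move=> VW xy; apply: eq_in_has => c cV; apply: eq_forallb => i.
rewrite !in_itv/= !ltNge (xy (i, c.1 ord0 i)) ?(xy (i, c.2 ord0 i))//;
  apply: VW; rewrite mem_cat; apply/orP; [right|left];
  by apply/allpairsP; exists (c, i); split; rewrite ?mem_enum.
Qed.

Lemma in_boxes_bounded (R : realType) (n : nat) (i : 'I_n)
    (V : seq ('rV[R]_n * 'rV[R]_n)) :
  exists M : R, forall x, in_boxes V x -> x ord0 i < M.
Proof.
elim: V => [|c V [M VM]]; first by exists 0.
exists (Num.max (c.2 ord0 i) M) => x /=; rewrite /in_boxes/= lt_max.
case/orP => [/forallP/(_ i)|/VM ->]; last by rewrite orbT.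
by rewrite in_itv/= => /andP[_ ->].
Qed.

(** The graph outputs some t such that x lies in V t, if there is one. To make
    this surjective, V t is enlarged by the cube with lower corner
    (M + j, ..., M + j) and side 1, where j is the rank of t and M lies beyond
    all the boxes. *)
Lemma box_classifier (R : realType) (n : nat) (n_gt0 : (0 < n)%N) (T : finType)
    (V : T -> seq ('rV[R]_n * 'rV[R]_n)) :
  exists G : linear_logical_graph R n (option T), forall x t,
    (forall t', in_boxes (V t') x = (t' == t)) -> llg_fun G x = Some t.
Proof.
pose i0 := Ordinal n_gt0.
have [M VM] : exists M : R, forall t x, in_boxes (V t) x -> x ord0 i0 < M.
  have [M VM] := in_boxes_bounded i0 (flatten [seq V t | t <- enum T]).
  exists M => t x /hasP[c cV cx]; apply: VM; apply/hasP; exists c => //.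
  by apply/flatten_mapP; exists t; rewrite ?mem_enum.
(* The half-open cube from p j to p j.+1 contains p j and no other p m, so p #|T|
   lies in no spare cube. *)
pose p (m : nat) : 'rV[R]_n := const_mx (M + m%:R).
pose V' t := (p (enum_rank t), p (enum_rank t).+1) :: V t.
have V'p t m : in_boxes (V' t) (p m) = (m == enum_rank t :> nat).
  rewrite /in_boxes/= -/(in_boxes _ _).
  have /negPf -> : ~~ in_boxes (V t) (p m).
    by apply/negP => /VM; rewrite mxE gtrDl ltNge ler0n.
  rewrite orbF; apply/forallP/eqP => [/(_ i0)|-> i].
    rewrite in_itv/= !mxE lerD2l ltrD2l ler_nat ltr_nat ltnS => mt.
    by apply/eqP; rewrite eqn_leq andbC.
  by rewrite in_itv/= !mxE lexx ltrD2l ltr_nat /=.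
(* A point of the original boxes has coordinate i0 below M, hence lies in no
   spare cube. *)
have V'V t x t' : in_boxes (V t) x -> in_boxes (V' t') x = in_boxes (V t') x.
  move=> /VM xM; rewrite /in_boxes/= -/(in_boxes _ _).
  case: forallP => //= /(_ i0); rewrite in_itv/= mxE => /andP[+ _].
  by move=> /le_lt_trans/(_ xM); rewrite gtrDl ltNge ler0n.
pose g x := [pick t | in_boxes (V' t) x].
have [||G Gg] := @same_side_graph R n (option T)
    (flatten [seq box_walls (V' t) | t <- enum T]) g.
- move=> x y xy; apply: eq_pick => t; apply: in_boxes_same_side xy => w wt.
  by apply/flatten_mapP; exists t; rewrite ?mem_enum.
- case=> [t|].
    exists (p (enum_rank t)); rewrite /g; case: pickP => [t'|/(_ t)].
      by rewrite V'p => /eqP/val_inj/enum_rank_inj ->.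
    by rewrite V'p eqxx.
  exists (p #|T|); rewrite /g; case: pickP => // t.
  by rewrite V'p => /eqP cT; have := ltn_ord (enum_rank t); rewrite -cT ltnn.
exists G => x t xt; rewrite Gg /g.
have xV' t' : in_boxes (V' t') x = (t' == t).
  by rewrite (@V'V t) ?xt.
by case: pickP => [t'|/(_ t)]; rewrite xV' ?eqxx// => /eqP ->.
Qed.

(** * Approximation of measurable functions *)

Theorem theorem1p1 (R : realType) (n : nat) (n_gt0 : (0 < n)%N)
    (D : set 'rV[R]_n) (mD : lebesgue_measurable D)
    (finD : (lebesgue_measure_rV D < +oo)%E)
    (T : finType) (f : D -> T) (mf : lebesgue_measurable_fun f)
    (eps : R) (eps_gt0 : 0 < eps) :
  exists (L : D -> option T) (E : set 'rV[R]_n),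
    [/\ linear_logical_function L,
        lebesgue_measurable E,
        (lebesgue_measure_rV E < eps%:E)%E &
        forall x : D, ~ E (set_val x) -> L x = Some (f x)].
Proof.
pose Df t : set 'rV[R]_n := set_val @` (f @^-1` [set t]).
have DfE (x : D) t : Df t (set_val x) <-> f x = t.
  by split => [[y <- /val_inj <-]|fx] //; exists x.
have fin_Df t : (lebesgue_outer (Df t) < +oo)%E.
  apply: le_lt_trans finD; apply: le_outer_measure => _ [x _ <-].
  exact: set_valP.
(* #|T| errors of size d add up to less than eps, also for empty T. *)
pose d := eps / #|T|.+1%:R.
have d_gt0 : 0 < d by rewrite divr_gt0.
have [V VDf] := @choice _ _ (fun t V =>
  (lebesgue_outer (Df t `+` in_boxes V) <= d%:E)%E)
  (fun t => boxes_approx (mf [set t]) (fin_Df t) d_gt0).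
have [G GV] := box_classifier n_gt0 V.
pose E := \big[setU/set0]_(t : T) (Df t `+` in_boxes (V t)).
exists (fun x => llg_fun G (set_val x)), E; split.
- by exists G.
- apply: (big_ind (@lebesgue_measurable R n)).
  + exact: (@measurable0 _ (caratheodory_type (@lebesgue_outer R n))).
  + exact: (@measurableU _ (caratheodory_type (@lebesgue_outer R n))).
  + move=> t _.
    apply: (@measurableU _ (caratheodory_type (@lebesgue_outer R n)));
    apply: (@measurableD _ (caratheodory_type (@lebesgue_outer R n))) => //;
    by [exact: mf|exact: in_boxes_measurable].
- apply: (@le_lt_trans _ _ (\sum_(t : T) d%:E)%E).
    apply: (big_ind2 (fun A (r : \bar R) => (lebesgue_outer A <= r)%E)).
    + by rewrite lebesgue_outer0.
    + move=> A r B s Ar Bs; apply: le_trans (outer_measureU2 _ _ _) _.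
      exact: leeD.
    + by move=> t _; exact: VDf.
  rewrite sumEFin lte_fin sumr_const -[X in X < _]mulr_natr /d.
  rewrite mulrAC ltr_pdivrMr// ltr_pM2l// ltr_nat.
  exact: ltnSn.
- move=> x nEx; apply: GV => t; apply/idP/eqP.
    move=> xV; apply/esym/DfE; apply: contrapT => nx; apply: nEx.
    by rewrite /E -bigcup_seq; exists t; rewrite /= ?mem_index_enum//; right.
  move=> ->; apply: contrapT => nx; apply: nEx; rewrite /E -bigcup_seq.
  by exists (f x); rewrite /= ?mem_index_enum//; left; split => //; apply/DfE.
Qed.
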